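(* Let $G$ be a graph and let $H$ be a connected graph in $\mathcal{IIM}_1(G)$. 1. If $G$ is connected then $\operatorname{diam}(H)\le\max\{\operatorname{diam}(G),5\}$. 2. If $G$ is disconnected then $\operatorname{diam}(H)\le 6$.
   Context: Graphs are finite, simple, undirected and nonempty. $N(v)$ is the neighborhood of $v$ and $N[v]=\{v\}\cup N(v)$. $\mathcal{IIM}_1(G)$ is the set of all graphs obtained from $G$ as follows: for every vertex $v\in V(G)$ add exactly one new vertex $v'$ (the copy of $v$), which is, by a choice made independently for each $v$, either a clone of $v$, meaning $N(v')=N[v]$, or an anticlone of $v$, meaning $N(v')=V(G)\setminus N[v]$; here $N[v]$ is taken in $G$, no edges are added among old vertices, and the new vertices are pairwise non-adjacent. $\operatorname{diam}(G)$ is the maximum distance between any pair of vertices of $G$. *)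

(* Defs.v *)
From mathcomp Require Import all_boot.

Set Implicit Arguments.
Unset Strict Implicit.
Unset Printing Implicit Defensive.

(** Finite, simple, undirected, nonempty graphs. *)
Record sgraph := SGraph {
  vertex :> finType;
  adj : rel vertex;
  adj_sym : symmetric adj;
  adj_irrefl : irreflexive adj;
  vertex_nonempty : 0 < #|vertex| }.

Definition open_nbhd (G : sgraph) (v : G) : {set G} := [set w | adj v w].
Definition closed_nbhd (G : sgraph) (v : G) : {set G} := v |: open_nbhd v.

Definition connected (G : sgraph) : Prop :=
  forall x y : G, connect (@adj G) x y.

Definition has_walk (G : sgraph) (n : nat) (x y : G) : bool :=
  [exists p : n.-tuple G, path (@adj G) x p && (last x p == y)].

(** The least length of a walk from x to y. A shortest walk has fewer than
    #|G| edges, so the search is bounded by #|G|, which is also the junk value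
    when y is not reachable from x; [dist_walk], [dist_le] and [dist_junk]
    characterize the result. *)
Definition dist (G : sgraph) (x y : G) : nat :=
  find (fun n => has_walk n x y) (iota 0 #|G|).

(** Meaningful for connected graphs only, because of the junk value of [dist]. *)
Definition diam (G : sgraph) : nat := \max_(x : G) \max_(y : G) dist x y.

Definition isomorphic (G H : sgraph) : Prop :=
  exists f : G -> H, bijective f /\ forall x y, adj (f x) (f y) = adj x y.

Section IIM1.
Variables (G : sgraph) (C : {set G}).

Definition copy_nbhd (v : G) : {set G} :=
  if v \in C then closed_nbhd v else ~: closed_nbhd v.

(** [inl v] is the old vertex v and [inr v] is its copy v', which is a clone
    if v is in C and an anticlone otherwise. *)
Definition iim1_adj (a b : G + G) : bool :=
  match a, b with
  | inl u, inl v => adj u v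
  | inl u, inr v => u \in copy_nbhd v
  | inr u, inl v => v \in copy_nbhd u
  | inr _, inr _ => false
  end.

Lemma iim1_adj_sym : symmetric iim1_adj.
Proof. by move=> [u|u] [v|v] //=; rewrite adj_sym. Qed.

Lemma iim1_adj_irrefl : irreflexive iim1_adj.
Proof. by move=> [u|u] //=; rewrite adj_irrefl. Qed.

Lemma iim1_nonempty : 0 < #|{: G + G}|.
Proof. by rewrite card_sum addn_gt0 vertex_nonempty. Qed.

Definition iim1 : sgraph := SGraph iim1_adj_sym iim1_adj_irrefl iim1_nonempty.

End IIM1.

(** Membership of H in IIM_1(G), where graphs are taken up to isomorphism. *)
Definition in_IIM1 (G H : sgraph) : Prop :=
  exists C : {set G}, isomorphic (iim1 C) H.

Section DistFacts.
Variable G : sgraph.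
Implicit Types x y : G.

Lemma has_walkP n x y :
  reflect (exists p : seq G, [/\ path (@adj G) x p, last x p = y & size p = n])
          (has_walk n x y).
Proof.
apply: (iffP existsP) => [[p /andP[xp /eqP lp]] | [p [xp lp /eqP sp]]].
  by exists p; rewrite size_tuple.
by exists (Tuple sp); rewrite /= xp lp eqxx.
Qed.

Lemma short_walk x y :
  connect (@adj G) x y -> exists2 n, n < #|G| & has_walk n x y.
Proof.
case/connectP=> p xp ->; case/shortenP: xp => q xq uq _; exists (size q).
  by have := max_card [in x :: q]; rewrite (card_uniqP uq).
by apply/has_walkP; exists q.
Qed.

Lemma dist_walk x y : connect (@adj G) x y -> has_walk (dist x y) x y.
Proof.
move=> /short_walk[n ltn w].
have hw : has (fun m => has_walk m x y) (iota 0 #|G|).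
  by apply/hasP; exists n; rewrite ?mem_iota.
have := nth_find 0 hw; rewrite nth_iota ?add0n //.
by rewrite -[ltnRHS](size_iota 0) -has_find.
Qed.

Lemma dist_le (x y : G) p : path (@adj G) x p -> last x p = y -> dist x y <= size p.
Proof.
move=> xp lp; rewrite leqNgt; apply/negP => lt.
have := before_find 0 lt; rewrite nth_iota ?add0n.
  have -> : has_walk (size p) x y by apply/has_walkP; exists p.
  by [].
by rewrite (leq_trans lt) // -[leqRHS](size_iota 0) find_size.
Qed.

Lemma dist_junk x y : ~~ connect (@adj G) x y -> dist x y = #|G|.
Proof.
move=> nxy; rewrite /dist hasNfind ?size_iota //.
apply/hasPn => n _; apply: contra nxy => /has_walkP[p [xp lp _]].
by apply/connectP; exists p.
Qed.

End DistFacts.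

(* Main.v *)
Require Import Defs.
From mathcomp Require Import all_boot.

Set Implicit Arguments.
Unset Strict Implicit.
Unset Printing Implicit Defensive.

(** If G is connected and u' is an anticlone, some walk u, w, z of G ends in a
    neighbour z of u', so d(u, u') <= 3; every old vertex is then at distance
    at most 4 from u' and every vertex at distance at most 5. Distances between
    vertices which are not anticlones are controlled by those of G.
    If G is disconnected and some anticlone u' has a neighbour in the component
    of u, then again d(u, u') <= 3, and every vertex is within 1 of u or within
    2 of u'; hence diam(H) <= 1 + 3 + 2. Otherwise each anticlone u' is
    adjacent exactly to the old vertices outside the component of u, and the
    connectivity of H puts any two old vertices at distance at most 4. *)

(** * Reachability and closed neighbourhoods *)

Lemma connect_exit (T : finType) (e : rel T) (P : pred T) x y :
  connect e x y -> P x -> ~~ P y -> exists a b, [/\ P a, ~~ P b & e a b].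
Proof.
case/connectP=> p + ->; elim: p x => [|z p IHp] x /=.
  by move=> _ Px; rewrite Px.
case/andP=> exz zp Px nPy; case Pz: (P z); first exact: (IHp z).
by exists x, z; rewrite Px Pz exz.
Qed.

Lemma adj_connect_sym (G : sgraph) : connect_sym (@adj G).
Proof. by apply: sym_connect_sym; apply: adj_sym. Qed.

Lemma in_closed_nbhd (G : sgraph) (v w : G) :
  (w \in closed_nbhd v) = (w == v) || adj v w.
Proof. by rewrite !inE. Qed.

Lemma closed_nbhd_sym (G : sgraph) (v w : G) :
  (w \in closed_nbhd v) = (v \in closed_nbhd w).
Proof. by rewrite !in_closed_nbhd eq_sym adj_sym. Qed.

Lemma closed_nbhd_connect (G : sgraph) (v w : G) :
  w \in closed_nbhd v -> connect (@adj G) v w.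
Proof. by rewrite in_closed_nbhd => /predU1P[->|/connect1]. Qed.

(** A path from [v] to [z] has an edge leaving $N[v]$; its inner end is not [v], whose neighbours
    all lie in $N[v]$. *)
Lemma exit_closed_nbhd (G : sgraph) (v z : G) :
  connect (@adj G) v z -> z \notin closed_nbhd v ->
  exists w t, [/\ adj v w, adj w t & t \notin closed_nbhd v].
Proof.
move=> vz nz; have vv : v \in closed_nbhd v by rewrite in_closed_nbhd eqxx.
have [w [t [vw nt wt]]] := connect_exit (P := mem (closed_nbhd v)) vz vv nz.
exists w, t; split=> //; move: vw; rewrite inE in_closed_nbhd => /predU1P[ewv|//].
by case/negP: nt; rewrite inE in_closed_nbhd -ewv wt orbT.
Qed.

Lemma exists_unreachable (G : sgraph) (u : G) :
  ~ connected G -> exists t : G, ~~ connect (@adj G) u t.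
Proof.
move=> nG; apply/existsP; apply: contra_notT nG; rewrite negb_exists => /forallP allu x y.
have /negPn ux := allu x; have /negPn uy := allu y.
by apply: connect_trans uy; rewrite adj_connect_sym.
Qed.

(** * The metric of a connected graph *)

Section ConnectedDist.
Variable G : sgraph.
Hypothesis Gc : connected G.
Implicit Types x y z : G.

Lemma shortest_path x y :
  exists p, [/\ path (@adj G) x p, last x p = y & size p = dist x y].
Proof. exact/has_walkP/dist_walk/Gc. Qed.

Lemma distxx x : dist x x = 0.
Proof. by apply/eqP; rewrite -leqn0 (@dist_le G x x [::]). Qed.

Lemma dist_adj x y : adj x y -> dist x y <= 1.
Proof. by move=> xy; apply: (@dist_le G x y [:: y]); rewrite //= xy. Qed.

Lemma dist_triangle y x z : dist x z <= dist x y + dist y z.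
Proof.
have [p [xp lp <-]] := shortest_path x y.
have [q [yq lq <-]] := shortest_path y z.
by rewrite -size_cat dist_le // ?cat_path ?last_cat lp // xp.
Qed.

Lemma dist_leD y m n x z : dist x y <= m -> dist y z <= n -> dist x z <= m + n.
Proof. by move=> xy yz; apply: leq_trans (dist_triangle y x z) (leq_add xy yz). Qed.

Lemma dist_adj_leS y n x z : adj x y -> dist y z <= n -> dist x z <= n.+1.
Proof. by move=> /dist_adj; apply: dist_leD. Qed.

Lemma dist_sym x y : dist x y = dist y x.
Proof.
suff le (u v : G) : dist u v <= dist v u by apply/eqP; rewrite eqn_leq !le.
have [p [vp lp <-]] := shortest_path v u.
rewrite -(size_belast v p) -size_rev dist_le //.
  by rewrite -lp rev_path (eq_path (e' := @adj G)) // => a b; apply: adj_sym.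
by rewrite -lp; case: (p) => //= a q; rewrite rev_cons last_rcons.
Qed.

Lemma dist_step x y : x != y -> exists2 w, adj x w & dist w y < dist x y.
Proof.
have [[|w p] [/= xp lp sp]] := shortest_path x y; first by rewrite lp eqxx.
move=> _; case/andP: xp => xw wp; exists w => //.
by rewrite -sp ltnS dist_le.
Qed.

Lemma connected_has_adj x y : x != y -> exists w, adj x w.
Proof. by case/dist_step=> w xw _; exists w. Qed.

End ConnectedDist.

(** * Diameter, homomorphisms and isomorphisms *)

Lemma dist_leq_diam (G : sgraph) (x y : G) : dist x y <= diam G.
Proof. exact: leq_trans (leq_bigmax y) (leq_bigmax x). Qed.

Lemma diam_leP (G : sgraph) n :
  reflect (forall x y : G, dist x y <= n) (diam G <= n).
Proof.
apply: (iffP idP) => [le x y | le]; first exact: leq_trans (dist_leq_diam x y) le.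
by apply/bigmax_leqP => x _; apply/bigmax_leqP => y _.
Qed.

Lemma hom_path (G H : sgraph) (f : G -> H) :
  {homo f : x y / adj x y} ->
  forall x p, path (@adj G) x p -> path (@adj H) (f x) (map f p).
Proof. by move=> fh x p; apply: homo_path. Qed.

Lemma hom_dist (G H : sgraph) (f : G -> H) :
  {homo f : x y / adj x y} -> connected G ->
  forall x y, dist (f x) (f y) <= dist x y.
Proof.
move=> fh Gc x y; have [p [xp <- <-]] := shortest_path Gc x y.
by rewrite -(size_map f) dist_le ?last_map ?hom_path.
Qed.

Lemma isomorphic_connected (G H : sgraph) :
  isomorphic G H -> connected H -> connected G.
Proof.
case=> f [[g fK gK] fadj] Hc x y.
have gh : {homo g : a b / adj a b} by move=> a b; rewrite -fadj !gK.
have [p [xp lp _]] := shortest_path Hc (f x) (f y).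
apply/connectP; exists (map g p); last by rewrite -[x]fK last_map lp fK.
by rewrite -[x]fK hom_path.
Qed.

Lemma isomorphic_diam_le (G H : sgraph) :
  isomorphic G H -> connected H -> diam H <= diam G.
Proof.
move=> GH Hc; have Gc := isomorphic_connected GH Hc.
case: GH => f [[g fK gK] fadj].
apply/diam_leP => x y; rewrite -[x]gK -[y]gK.
have fh : {homo f : a b / adj a b} by move=> a b; rewrite fadj.
exact: leq_trans (hom_dist fh Gc _ _) (dist_leq_diam _ _).
Qed.

(** * Distances in a connected graph of clones and anticlones *)

Section Copies.
Variables (G : sgraph) (C : {set G}).
Hypothesis Hc : connected (iim1 C).

Local Notation H := (iim1 C).
Local Notation old u := (inl u : H).
Local Notation copy u := (inr u : H).
Local Notation conn := (connect (@adj G)).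

Lemma adj_old (u v : G) : @adj H (old u) (old v) = adj u v.
Proof. by []. Qed.

Lemma adj_clone (u v : G) :
  u \in C -> @adj H (copy u) (old v) = (v \in closed_nbhd u).
Proof. by rewrite /= /copy_nbhd => ->. Qed.

Lemma adj_anticlone (u v : G) :
  u \notin C -> @adj H (copy u) (old v) = (v \notin closed_nbhd u).
Proof. by rewrite /= /copy_nbhd => /negbTE ->; rewrite inE. Qed.

Lemma copy_has_nbr (u : G) : exists v, @adj H (copy u) (old v).
Proof.
have [//|[v|v] // uv] := @connected_has_adj H Hc (copy u) (old u).
by exists v.
Qed.

Lemma dist_old (u v : G) : connected G -> @dist H (old u) (old v) <= dist u v.
Proof. by move=> Gc; apply: (@hom_dist G H inl). Qed.

(** A clone can replace [u] as the start of a shortest path from [u]; the 1 covers [u = v], since a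
    clone is adjacent to its original. *)
Lemma dist_clone_old (u v : G) : connected G -> u \in C ->
  @dist H (copy u) (old v) <= maxn (dist u v) 1.
Proof.
move=> Gc uC; have [<-|nuv] := eqVneq u v.
  by rewrite (leq_trans _ (leq_maxr _ _)) // dist_adj // adj_clone // in_closed_nbhd eqxx.
have [w uw lt] := dist_step Gc nuv.
apply: leq_trans (leq_maxl _ _); apply: leq_trans lt.
apply: (dist_adj_leS Hc (y := old w)); last exact: dist_old.
by rewrite adj_clone // in_closed_nbhd uw orbT.
Qed.

(** Both ends of a shortest path are replaced by clones; the 2 covers adjacent [u] and [v], where
    the step from [u] may already reach [v]. *)
Lemma dist_clone_clone (u v : G) : connected G -> u \in C -> v \in C ->
  @dist H (copy u) (copy v) <= maxn (dist u v) 2.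
Proof.
move=> Gc uC vC; have [<-|nuv] := eqVneq u v; first by rewrite distxx.
have [w uw lt] := dist_step Gc nuv.
have le : maxn (dist w v) 1 < maxn (dist u v) 2.
  by rewrite -maxnSS geq_max !leq_max lt leqnn orbT.
apply: leq_trans le; apply: (dist_adj_leS Hc (y := old w)).
  by rewrite adj_clone // in_closed_nbhd uw orbT.
by rewrite (dist_sym Hc) (dist_sym Gc) dist_clone_old.
Qed.

Lemma dist_anticlone_self (u z : G) :
  u \notin C -> conn u z -> z \notin closed_nbhd u ->
  @dist H (old u) (copy u) <= 3.
Proof.
move=> uC uz nz; have [w [t [uw wt nt]]] := exit_closed_nbhd uz nz.
apply: (dist_adj_leS Hc (y := old w)) => //.
apply: (dist_adj_leS Hc (y := old t)) => //.
by rewrite (dist_sym Hc) dist_adj // adj_anticlone.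
Qed.

Lemma dist_old_anticlone (u x : G) : connected G -> u \notin C ->
  @dist H (old x) (copy u) <= 4.
Proof.
move=> Gc uC; have [xu|nxu] := boolP (x \in closed_nbhd u); last first.
  by rewrite (dist_sym Hc) (leq_trans (n := 1)) // dist_adj // adj_anticlone.
(* Connectivity of [H] gives the anticlone a neighbour, so $N[u]$ is not all of [G]. *)
have [z] := copy_has_nbr u; rewrite adj_anticlone // => nz.
have le3 := dist_anticlone_self uC (Gc u z) nz.
move: xu; rewrite in_closed_nbhd => /predU1P[->|ux]; first exact: leqW.
by apply: (dist_adj_leS Hc (y := old u)); rewrite // adj_old adj_sym.
Qed.

Lemma dist_anticlone (u : G) (a : H) : connected G -> u \notin C ->
  dist a (copy u) <= 5.
Proof.
move=> Gc uC; case: a => x; first exact: leqW (dist_old_anticlone x Gc uC).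
have [y xy] := copy_has_nbr x.
exact: (dist_adj_leS Hc xy (dist_old_anticlone y Gc uC)).
Qed.

Lemma iim1_diam_connected : connected G -> diam H <= maxn (diam G) 5.
Proof.
move=> Gc; apply/diam_leP.
(* Below, [k] is the number of clones among the two endpoints. *)
have maxle (u v : G) k : k <= 5 -> maxn (dist u v) k <= maxn (diam G) 5.
  by move=> k5; rewrite geq_max !leq_max dist_leq_diam k5 orbT.
have anti a u : u \notin C -> dist a (copy u) <= maxn (diam G) 5.
  by move=> uC; rewrite leq_max dist_anticlone ?orbT.
move=> [u|u] [v|v].
- by apply: leq_trans (maxle u v 0 _); rewrite // maxn0 dist_old.
- have [vC|] := boolP (v \in C); last exact: anti.
  by rewrite (dist_sym Hc) (leq_trans (dist_clone_old _ _ _)) ?maxle.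
- have [uC|uC] := boolP (u \in C); last by rewrite (dist_sym Hc) anti.
  by rewrite (leq_trans (dist_clone_old _ _ _)) ?maxle.
- have [vC|] := boolP (v \in C); last exact: anti.
  have [uC|uC] := boolP (u \in C); last by rewrite (dist_sym Hc) anti.
  by rewrite (leq_trans (dist_clone_clone _ _ _)) ?maxle.
Qed.

(** * Disconnected [G]: an anticlone with a neighbour in the component of its original *)

(** The critical case is a copy of [p] whose neighbours all lie in $N[u]$. If it is a clone, then
    [p] lies in $N[u]$ and the clone is adjacent to [u]. If it is an anticlone, then $N[p]$ contains
    every vertex outside $N[u]$, hence meets two components, which is impossible. *)
Lemma near_anticlone_or_original (u z : G) (a : H) :
  ~ connected G -> u \notin C -> conn u z -> z \notin closed_nbhd u ->
  dist a (copy u) <= 2 \/ dist a (old u) <= 1.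
Proof.
move=> nG uC uz nz.
have near y : y \notin closed_nbhd u -> dist (old y) (copy u) <= 1.
  by move=> ny; rewrite (dist_sym Hc) dist_adj // adj_anticlone.
case: a => p.
  have [pu|npu] := boolP (p \in closed_nbhd u); last by left; rewrite leqW ?near.
  right; move: pu; rewrite in_closed_nbhd => /predU1P[->|up]; first by rewrite distxx.
  by rewrite dist_adj // adj_old adj_sym.
case: (pickP [pred y | adj (copy p) (old y) && (y \notin closed_nbhd u)]).
  by move=> y /andP[py ny]; left; apply: (dist_adj_leS Hc py (near y ny)).
move=> sub; have [pC|pC] := boolP (p \in C).
  right; apply: dist_adj; rewrite adj_clone // closed_nbhd_sym.
  have := sub p; rewrite inE adj_clone // in_closed_nbhd eqxx /=.
  by move/negbFE.
have cover y : y \notin closed_nbhd u -> y \in closed_nbhd p.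
  by move=> ny; move: (sub y); rewrite inE adj_anticlone // ny andbT => /negbFE.
have [t nut] := exists_unreachable u nG.
have nt : t \notin closed_nbhd u by apply: contra nut => /closed_nbhd_connect.
(* Both [z], in the component of [u], and [t], in another one, lie in $N[p]$. *)
case/negP: nut; apply: connect_trans (closed_nbhd_connect (cover t nt)).
by rewrite (connect_trans uz) // adj_connect_sym closed_nbhd_connect ?cover.
Qed.

Lemma iim1_diam_local_anticlone (u z : G) :
  ~ connected G -> u \notin C -> conn u z -> z \notin closed_nbhd u ->
  diam H <= 6.
Proof.
move=> nG uC uz nz; apply/diam_leP => a b.
have le3 := dist_anticlone_self uC uz nz.
have near c := near_anticlone_or_original c nG uC uz nz.
(* The extremal case: 2 to the anticlone, 3 from it to [u], 1 from [u]. *)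
have far c d : dist c (copy u) <= 2 -> dist d (old u) <= 1 -> dist c d <= 6.
  move=> cu du; apply: (dist_leD Hc (m := 2) (n := 4) cu).
  by apply: (dist_leD Hc (m := 3) (n := 1) (y := old u)); rewrite (dist_sym Hc).
have [au|au] := near a; have [bu|bu] := near b.
- by rewrite (leq_trans (n := 4)) // (dist_leD Hc (m := 2) (n := 2) au) // (dist_sym Hc).
- exact: far.
- by rewrite (dist_sym Hc) far.
- by rewrite (leq_trans (n := 2)) // (dist_leD Hc (m := 1) (n := 1) au) // (dist_sym Hc).
Qed.

(** * Disconnected [G]: every anticlone sees exactly the other components *)

Section GlobalAnticlones.
Hypothesis glob : forall u z : G, u \notin C -> conn u z -> z \in closed_nbhd u.

Lemma adj_global_anticlone (u v : G) :
  u \notin C -> @adj H (copy u) (old v) = ~~ conn u v.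
Proof.
move=> uC; rewrite adj_anticlone //; congr negb.
by apply/idP/idP => [/closed_nbhd_connect|/(glob uC)].
Qed.

Lemma adj_clone_conn (u v : G) :
  u \in C -> @adj H (copy u) (old v) -> conn u v.
Proof. by move=> uC; rewrite adj_clone // => /closed_nbhd_connect. Qed.

(** The component of [x] together with the clones of its vertices can be left in [H] only through an
    anticlone adjacent to that component, and the original of such an anticlone lies elsewhere. *)
Lemma exists_anticlone_elsewhere (x : G) :
  ~ connected G -> exists2 v, v \notin C & ~~ conn x v.
Proof.
move=> nG; have [t nxt] := exists_unreachable x nG.
pose P (a : H) :=
  match a with inl y => conn x y | inr y => (y \in C) && conn x y end.
have [[a|a] [[b|b] [Pa Pb ab]]] := connect_exit (P := P) (Hc (old x) (old t))
  (connect0 _ x) nxt.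
- by case/negP: Pb => /=; apply: connect_trans Pa _; apply: connect1.
- rewrite adj_sym in ab; have [bC|bC] := boolP (b \in C); last first.
    exists b => //; move: ab; rewrite adj_global_anticlone //; apply: contra => xb.
    by rewrite adj_connect_sym in xb; apply: connect_trans xb Pa.
  case/negP: Pb => /=; rewrite bC (connect_trans Pa) //.
  by rewrite adj_connect_sym adj_clone_conn.
- case/andP: Pa => aC xa; case/negP: Pb => /=; apply: connect_trans xa _.
  exact: adj_clone_conn.
- by [].
Qed.

(** If the components of [x] and [y] were the only ones, the component of [x], its clones and the
    anticlones from the component of [y] would be closed under adjacency in [H] and miss [y],
    against connectivity. *)
Lemma exists_third_component (x y : G) :
  ~~ conn x y -> exists2 c, ~~ conn x c & ~~ conn y c.
Proof.
move=> nxy.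
case: (pickP [pred c | ~~ conn x c && ~~ conn y c]) => [c /andP[] | no].
  by exists c.
have two c : ~~ conn y c -> conn x c.
  by move=> yc; move: (no c); rewrite /= yc andbT => /negbFE.
pose P (a : H) :=
  match a with inl z => conn x z | inr z => conn (if z \in C then x else y) z end.
have [[a|a] [[b|b] [Pa Pb ab]]] := connect_exit (P := P) (Hc (old x) (old y))
  (connect0 _ x) nxy.
- by case/negP: Pb => /=; apply: connect_trans Pa _; apply: connect1.
- rewrite adj_sym in ab; case/negP: Pb => /=; have [bC|bC] := boolP (b \in C).
    by rewrite (connect_trans Pa) // adj_connect_sym adj_clone_conn.
  move: ab; rewrite adj_global_anticlone //; apply: contraR => /two xb.
  by rewrite adj_connect_sym in xb; apply: connect_trans xb Pa.
- case/negP: Pb; move: Pa => /=; have [aC|aC] := boolP (a \in C) => Pa.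
    by apply: connect_trans Pa _; apply: adj_clone_conn.
  apply: two; move: ab; rewrite adj_global_anticlone //; apply: contra => yb.
  by rewrite adj_connect_sym in Pa; apply: connect_trans Pa yb.
- by [].
Qed.

Lemma dist_old_anticlone_conn (v x : G) :
  v \notin C -> ~~ conn x v -> @dist H (old x) (copy v) <= 1.
Proof.
move=> vC xv; rewrite (dist_sym Hc) dist_adj // adj_global_anticlone //.
by rewrite adj_connect_sym.
Qed.

Lemma dist_old_old_global (x y : G) :
  ~ connected G -> @dist H (old x) (old y) <= 4.
Proof.
move=> nG.
(* An anticlone whose original is in neither component is a common neighbour. *)
have via v p q : v \notin C -> ~~ conn p v -> ~~ conn q v ->
    @dist H (old p) (old q) <= 2.
  move=> vC pv qv; apply: (dist_leD Hc (m := 1) (n := 1) (y := copy v)).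
    exact: dist_old_anticlone_conn.
  by rewrite (dist_sym Hc) dist_old_anticlone_conn.
have [v vC xv] := exists_anticlone_elsewhere x nG.
have [w wC yw] := exists_anticlone_elsewhere y nG.
have [yv|yv] := boolP (conn y v); last by rewrite (leq_trans (via v x y _ _ _)).
have [xw|xw] := boolP (conn x w); last by rewrite (leq_trans (via w x y _ _ _)).
have nxy : ~~ conn x y by apply: contra xv => /connect_trans; apply.
(* Now [v] is in the component of [y] and [w] in that of [x], so a vertex [c] of a third component
   is within 2 of [x] through the copy of [v] and within 2 of [y] through the copy of [w]. *)
have [c xc yc] := exists_third_component nxy.
apply: (dist_leD Hc (m := 2) (n := 2) (y := old c)).
  apply: via vC xv _; apply: contra yc => cv.
  by rewrite adj_connect_sym in cv; apply: connect_trans yv cv.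
apply: via wC _ yw; apply: contra xc => cw.
by rewrite adj_connect_sym in cw; apply: connect_trans xw cw.
Qed.

Lemma iim1_diam_global_anticlones : ~ connected G -> diam H <= 6.
Proof.
move=> nG; apply/diam_leP.
have near (a : H) : exists x, dist a (old x) <= 1.
  case: a => u; first by exists u; rewrite distxx.
  by have [v uv] := copy_has_nbr u; exists v; apply: dist_adj.
move=> a b; have [x ax] := near a; have [y yb] := near b.
rewrite (dist_sym Hc) in yb.
(* The bound is 1 + 4 + 1. *)
exact: (dist_leD Hc ax (dist_leD Hc (dist_old_old_global x y nG) yb)).
Qed.

End GlobalAnticlones.

(** * Combining the cases and transporting along the isomorphism *)

Lemma iim1_diam_disconnected : ~ connected G -> diam H <= 6.
Proof.
move=> nG.
(* Either some anticlone has a neighbour in the component of its original, or all anticlones are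
   global. *)
case: (pickP [pred p : G * G |
  [&& p.1 \notin C, conn p.1 p.2 & p.2 \notin closed_nbhd p.1]]).
  by move=> [u z] /and3P[]; apply: iim1_diam_local_anticlone.
move=> no; apply: iim1_diam_global_anticlones => // u z uC uz.
by move: (no (u, z)); rewrite /= uC uz => /negbFE.
Qed.

End Copies.

Theorem theorem4p1 (G H : sgraph) (HG : in_IIM1 G H) (Hconn : connected H) :
  (connected G -> diam H <= maxn (diam G) 5) /\
  (~ connected G -> diam H <= 6).
Proof.
case: HG => C GH; have Hc := isomorphic_connected GH Hconn.
have le := isomorphic_diam_le GH Hconn.
split=> hG; apply: leq_trans le _.
  exact: iim1_diam_connected.
exact: iim1_diam_disconnected.
Qed.
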